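(* For every $k$ and $\varepsilon>0$ there are $(m,k)$-PMDs $Z_1,\dots,Z_\ell$ with $m=O(\log^{k-1}(1/\varepsilon))$ and $\ell=2^{\tilde\Omega(\log^{k-1}(1/\varepsilon))}$ such that $d_{\mathrm{TV}}(Z_i,Z_j)\ge\varepsilon$ for all $1\le i<j\le\ell$.
   Context: A $k$-CRV is a random vector supported on $\{e_1,\dots,e_k\}\subset\mathbb{R}^k$; an $(m,k)$-PMD is the distribution of a sum of $m$ independent $k$-CRVs. The $\tilde\Omega$ hides factors of $\mathrm{poly}(\log\log(1/\varepsilon))$ and dependence on $k$. $d_{\mathrm{TV}}$ denotes total variation distance.
   Formalization: Proved for k ≥ 2 and 0 < ε ≤ 1/4: for k = 1 there is only one (m,1)-PMD, so the claim fails, and for ε > 1 no d_TV reaches ε; for ε near 1 the factor log log(1/ε) is not positive and the asymptotic bounds lose meaning. *)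

(* Defs.v *)
From HB Require Import structures.
From mathcomp Require Import all_boot all_order all_algebra.
From mathcomp Require Import all_classical all_reals all_analysis.
Set Implicit Arguments.
Unset Strict Implicit.
Unset Printing Implicit Defensive.
Import Order.TTheory GRing.Theory Num.Theory.
Import numFieldNormedType.Exports.
Local Open Scope classical_set_scope.
Local Open Scope ring_scope.

Definition log2 (R : realType) (x : R) : R := ln x / ln 2.

(* R^k with its Borel sigma-algebra *)
Definition borel_rV (R : realType) (k : nat) :=
  g_sigma_algebraType (@open 'rV[R]_k).

(* Taking some of the A i to be the full set gives the product rule for every
   subfamily. *)
Definition mutually_independent (R : realType) (d d' : measure_display)
    (T : measurableType d) (T' : measurableType d') (P : probability T R)
    (m : nat) (X : 'I_m -> {RV P >-> T'}) : Prop :=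
  forall A : 'I_m -> set T', (forall i, measurable (A i)) ->
    P (\bigcap_(i in [set: 'I_m]) (X i @^-1` A i)) =
    (\prod_(i < m) P (X i @^-1` A i))%E.

Definition is_CRV (R : realType) (d : measure_display) (T : measurableType d)
    (P : probability T R) (k : nat) (X : {RV P >-> borel_rV R k}) : Prop :=
  distribution P X [set v | exists j : 'I_k, v = delta_mx 0 j] = 1%E.

Definition is_PMD (R : realType) (m k : nat)
    (mu : probability (borel_rV R k) R) : Prop :=
  exists (d : measure_display) (T : measurableType d) (P : probability T R)
         (X : 'I_m -> {RV P >-> borel_rV R k}),
    [/\ forall i, is_CRV (X i),
        mutually_independent X &
        forall A : set (borel_rV R k), measurable A ->
          mu A = P ((fun t => \sum_(i < m) (X i t : 'rV[R]_k)) @^-1` A)].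

Definition dTV (R : realType) (d : measure_display) (T : measurableType d)
    (mu nu : probability T R) : \bar R :=
  ereal_sup [set `|mu A - nu A|%E | A in measurable].

(* Main.v *)
Require Import Defs.
From HB Require Import structures.
From mathcomp Require Import all_boot all_order all_algebra.
From mathcomp Require Import all_classical all_reals all_analysis.
From mathcomp Require Import ring zify.
Import Order.TTheory GRing.Theory Num.Theory.
Import numFieldNormedType.Exports.
Local Open Scope classical_set_scope.
Local Open Scope ring_scope.

Set Implicit Arguments.
Unset Strict Implicit.
Unset Printing Implicit Defensive.

(* Let d = k - 1. Take the grid {1,...,n}^d with n of order L / log L, where
   L = log2 (1/eps), and for each subset S of the grid let Z_S be the sum of n^d
   independent CRVs, one per grid point s: if s is in S, the CRV is e_j with
   probability s_j / N, where N = k n, and the last basis vector otherwise; if s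
   is not in S, it is constantly that last vector. For an integer vector v, the
   factorial moments of Z_S are the coefficients of prod_(s in S) (1 + (s.v / N) X):
   the coefficient of X^r is an integer multiple of N^-r, while it moves by at most
   eps (n^d |v|_oo)^r when the law moves by eps in total variation. Hence if two
   Z_S are eps-close, all these coefficients with r <= N and v in [0,N]^d agree
   exactly. By Newton's identities so do the power sums sum_(s in S) (s.v)^r, then
   by interpolation in v and polarization so do the sums over S of all polynomials
   of degree at most N without constant term, and Lagrange interpolation on the
   grid recovers S. *)

(** * Power sums and elementary symmetric polynomials *)

(** Generating polynomial of the elementary symmetric functions. Working over a semiring lets one
    definition serve both [nat] and real families. *)
Definition esym_poly (A : comNzSemiRingType) (I : finType) (a : I -> A) : {poly A} :=
  \prod_i (1 + a i *: 'X).

Lemma coef_lin_mul (A : comNzSemiRingType) (a : A) (p : {poly A}) r :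
  ((1 + a *: 'X) * p)`_r = p`_r + (if r is r'.+1 then a * p`_r' else 0).
Proof.
by rewrite mulrDl mul1r coefD -scalerAl coefZ coefXM; case: r => //=; rewrite mulr0.
Qed.

Lemma coef_esym_natr (A : comNzSemiRingType) (I : finType) (a : I -> nat) r :
  (esym_poly (fun i => (a i)%:R : A))`_r = ((esym_poly a)`_r)%R%:R.
Proof.
rewrite /esym_poly; elim: (index_enum I) r => [|i s IHs] r.
  by rewrite !big_nil !coef1; case: r.
rewrite !big_cons !coef_lin_mul IHs; case: r => [|r]; first by rewrite !addr0.
by rewrite IHs natrD natrM.
Qed.

Lemma coef_esym_scale (A : comNzSemiRingType) (I : finType) (a : I -> A) c r :
  (esym_poly (fun i => c * a i))`_r = c ^+ r * (esym_poly a)`_r.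
Proof.
rewrite /esym_poly; elim: (index_enum I) r => [|i s IHs] r.
  by rewrite !big_nil !coef1; case: r => [|r]; rewrite ?expr0 ?mul1r ?mulr0.
rewrite !big_cons !coef_lin_mul IHs; case: r => [|r]; first by rewrite !addr0.
by rewrite IHs mulrDr exprS !mulrA; congr (_ + _ * _); rewrite mulrAC.
Qed.

(** The multinomial expansion of the power on the right contains every monomial of the elementary
    symmetric function. *)
Lemma coef_esym_le (I : finType) (a : I -> nat) r :
  (((esym_poly a)`_r)%R <= (\sum_i a i) ^ r)%N.
Proof.
rewrite /esym_poly; elim: (index_enum I) r => [|i s IHs] r.
  by rewrite !big_nil !coef1; case: r.
rewrite !big_cons coef_lin_mul; case: r => [|r];
  first by rewrite addr0 (leq_trans (IHs 0%N)).
set S := (\sum_(j <- s) a j)%N.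
have : (S ^ r.+1 + a i * S ^ r <= (a i + S) ^ r.+1)%N.
  rewrite !expnS -mulnDl addnC leq_mul2l; apply/orP; right.
  by case: r => // r; rewrite leq_exp2r// leq_addl.
by apply: leq_trans; rewrite leq_add// leq_mul2l IHs orbT.
Qed.

Lemma coef0_esym (A : comNzSemiRingType) (I : finType) (a : I -> A) :
  (esym_poly a)`_0 = 1.
Proof.
rewrite /esym_poly; elim: (index_enum I) => [|i s IHs]; first by rewrite big_nil coef1.
by rewrite big_cons coef_lin_mul addr0.
Qed.

(** Newton's identities: the inner sum is, up to sign, the power sum of order [n - j + 1]. *)
Lemma coef_deriv_esym (A : comNzRingType) (I : finType) (a : I -> A) n :
  (esym_poly a)^`()`_n =
  \sum_(j < n.+1) (esym_poly a)`_j * \sum_i a i * (- a i) ^+ (n - j).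
Proof.
pose P (s : seq I) := \sum_(i <- s) a i *: \sum_(r < n.+1) (- a i *: 'X) ^+ r.
have cP s r : (r <= n)%N -> (P s)`_r = \sum_(i <- s) a i * (- a i) ^+ r.
  move=> rn; rewrite coef_sum; apply: eq_bigr => i _; rewrite coefZ; congr (_ * _).
  rewrite coef_sum (bigD1 (Ordinal (rn : (r < n.+1)%N)))//= big1 => [|j jr].
    by rewrite exprZn coefZ coefXn eqxx mulr1 addr0.
  rewrite exprZn coefZ coefXn; case: eqP => [rj|_]; rewrite ?mulr0//.
  by case/eqP: jr; apply: val_inj.
(* Logarithmic derivative: F' / F = sum_i a_i / (1 + a_i X), expanded up to X^n. *)
have [Q FQ] : exists Q : {poly A},
    (esym_poly a)^`() = esym_poly a * P (index_enum I) + 'X^(n.+1) * Q.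
  rewrite /esym_poly; elim: (index_enum I) => [|i s [Q IHs]].
    by exists 0; rewrite /P !big_nil derivC mulr0 mulr0 addr0.
  rewrite /P !big_cons; set G := \prod_(j <- s) _ in IHs *; set PG := P s in IHs.
  set S := \sum_(r < n.+1) _; rewrite -/(P s) -/PG derivM IHs.
  have geo : (1 + a i *: 'X) * S = 1 - (- a i *: 'X) ^+ n.+1.
    rewrite -[in RHS](expr1n _ n.+1) subrXX -[a i in LHS]opprK scaleNr.
    by congr (_ * _); apply: eq_bigr => r _; rewrite expr1n mul1r.
  exists ((1 + a i *: 'X) * Q + (a i * (- a i) ^+ n.+1) *: G).
  rewrite derivD derivC derivZ derivX add0r.
  transitivity (a i *: G * ((1 + a i *: 'X) * S) +
      (1 + a i *: 'X) * (G * PG + 'X^(n.+1) * Q) +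
      'X^(n.+1) * ((a i * (- a i) ^+ n.+1) *: G)); last by rewrite -!mul_polyC; ring.
  by rewrite geo exprZn -!mul_polyC polyCM; ring.
rewrite FQ coefD coefXnM ltnSn addr0 coefM; apply: eq_bigr => j _.
by rewrite cP ?leq_subr.
Qed.

Lemma power_sums_eq (A : comNzRingType) (I : finType) (a b : I -> A) N :
  (forall r, (r <= N)%N -> (esym_poly a)`_r = (esym_poly b)`_r) ->
  forall r, (0 < r <= N)%N -> \sum_i a i ^+ r = \sum_i b i ^+ r.
Proof.
move=> ab.
have ps r : (r < N)%N ->
    \sum_i a i * (- a i) ^+ r = \sum_i b i * (- b i) ^+ r.
  elim/ltn_ind: r => r IHr rN.
  have := coef_deriv_esym a r; have := coef_deriv_esym b r.
  rewrite !coef_deriv -ab// => ->.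
  rewrite !big_ord_recl !coef0_esym !mul1r subn0 => /eqP.
  rewrite -subr_eq => /eqP <-; apply/eqP; rewrite subr_eq eq_sym; apply/eqP.
  congr (_ + _); apply: eq_bigr => j _; rewrite ab ?(leq_trans (ltn_ord j) (ltnW rN))//.
  congr (_ * _); apply/IHr; last by rewrite (leq_ltn_trans _ rN)// leq_subr.
  by rewrite /= /bump add1n ltn_subrL; case: (r) j => // -[].
case=> // r /andP[_ rN]; have := ps _ rN.
have sgn (c : I -> A) : \sum_i c i * (- c i) ^+ r = (-1) ^+ r * \sum_i c i ^+ r.+1.
  rewrite mulr_sumr; apply: eq_bigr => i _.
  by rewrite [(- c i) ^+ r]exprNn exprS mulrCA.
rewrite !sgn => /(congr1 (fun z => (-1) ^+ r * z)).
by rewrite !mulrA -exprMn mulrNN mulr1 expr1n !mul1r.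
Qed.

(** * Measures on a grid are determined by their directional moments *)

Section BinomialPowers.
Variables (F : numFieldType) (I : finType) (mu : I -> F).

(** A moment sum of degree [n] restricted to a line of directions, as a polynomial in the line
    parameter. *)
Definition binom_pow_poly (a b : I -> F) n : {poly F} :=
  \sum_i mu i *: ((a i)%:P + b i *: 'X) ^+ n.

Lemma horner_binom_pow_poly a b n x :
  (binom_pow_poly a b n).[x] = \sum_i mu i * (a i + b i * x) ^+ n.
Proof. by rewrite horner_sum; apply: eq_bigr => i _; rewrite !hornerE. Qed.

Lemma binom_pow_poly_eq0 a b n :
  (forall t, (t <= n)%N -> \sum_i mu i * (a i + b i * t%:R) ^+ n = 0) ->
  binom_pow_poly a b n = 0.
Proof.
move=> ab0; apply: (@roots_geq_poly_eq0 _ _ [seq t%:R | t <- iota 0 n.+1]).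
- apply/allP => _ /mapP[t + ->]; rewrite mem_iota/= ltnS => tn.
  by rewrite /root horner_binom_pow_poly ab0.
- by rewrite map_inj_uniq ?iota_uniq// => s t /eqP; rewrite eqr_nat => /eqP.
- rewrite size_map size_iota; apply: (leq_trans (size_sum _ _ _)).
  apply/bigmax_leqP => i _; apply: (leq_trans (size_scale_leq _ _)).
  apply: (leq_trans (size_poly_exp_leq _ _)); rewrite ltnS.
  rewrite -[leqRHS]mul1n leq_mul2r; apply/orP; right.
  rewrite -subn1 leq_subLR (leq_trans (size_polyD _ _))// geq_max.
  rewrite (leq_trans (size_polyC_leq1 _))//.
  by rewrite (leq_trans (size_scale_leq _ _))// size_polyX.
Qed.

Lemma deriv_binom_pow_poly a b n :
  (binom_pow_poly a b n.+1)^`().[0] = n.+1%:R * \sum_i mu i * b i * a i ^+ n.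
Proof.
rewrite /binom_pow_poly raddf_sum/= horner_sum mulr_sumr; apply: eq_bigr => i _.
rewrite derivZ deriv_exp derivD derivC derivZ derivX add0r alg_polyC.
rewrite hornerZ hornerMn hornerM horner_exp !hornerE -mulr_natl/=; ring.
Qed.
End BinomialPowers.

Section Multimoments.
Variables (F : numFieldType) (I : finType) (mu : I -> F).
Variables (d : nat) (x : I -> 'I_d -> F) (N : nat).

Let dot (v : 'I_d -> F) i := \sum_j v j * x i j.

Hypothesis power_sums0 : forall v : 'I_d -> nat, (forall j, v j <= N)%N ->
  forall r, (0 < r <= N)%N -> \sum_i mu i * dot (fun j => (v j)%:R) i ^+ r = 0.

Let dot_upd v j t i : dot (fun l => if l == j then t else v l) i =
  \sum_(l | l != j) v l * x i l + x i j * t.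
Proof.
rewrite /dot (bigD1 j)//= eqxx addrC [t * _]mulrC; congr (_ + _).
by apply: eq_bigr => l /negbTE ->.
Qed.

Lemma power_sums_all v r : (0 < r <= N)%N -> \sum_i mu i * dot v i ^+ r = 0.
Proof.
move=> rN.
(* Free the coordinates of v one at a time: a polynomial of degree r with r + 1
   roots vanishes. *)
suff H h w : (h <= d)%N ->
    (forall j : 'I_d, (h <= j)%N -> exists2 t, (t <= N)%N & w j = t%:R) ->
    \sum_i mu i * dot w i ^+ r = 0.
  by apply: (H d) => // j; rewrite leqNgt ltn_ord.
elim: h w => [w _ wN|h IHh w hd wN].
  have {}wN j : exists t, (t <= N)%N && (w j == t%:R).
    by have [t tN ->] := wN j isT; exists t; rewrite tN eqxx.
  pose u j := xchoose (wN j).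
  have uP j : (u j <= N)%N && (w j == (u j)%:R) := xchooseP (wN j).
  have uN j : (u j <= N)%N by case/andP: (uP j).
  transitivity (\sum_i mu i * dot (fun j => (u j)%:R) i ^+ r); last exact: power_sums0.
  apply: eq_bigr => i _; congr (_ * _ ^+ _).
  by apply: eq_bigr => j _; case/andP: (uP j) => _ /eqP ->.
pose j := Ordinal hd.
pose a i := \sum_(l | l != j) w l * x i l.
have dotw t i : dot (fun l => if l == j then t else w l) i = a i + x i j * t
  := dot_upd w j t i.
have : binom_pow_poly mu a (x^~ j) r = 0.
  apply: binom_pow_poly_eq0 => t tr; under eq_bigr do rewrite -dotw.
  apply: IHh => [|l hl]; first exact: ltnW.
  have [_|lj] := eqVneq l j.
    by exists t => //; apply: leq_trans tr _; case/andP: rN.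
  by apply: wN; rewrite ltn_neqAle hl andbT eq_sym.
move=> /(congr1 (horner^~ (w j))); rewrite horner_binom_pow_poly horner0 => q0.
rewrite -[RHS]q0; apply: eq_bigr => i _; rewrite -dotw; congr (_ * _ ^+ _).
by apply: eq_bigr => l _; case: eqVneq => // ->.
Qed.

Lemma polarization (js : seq 'I_d) v r :
  (0 < size js + r <= N)%N ->
  \sum_i mu i * (\prod_(j <- js) x i j) * dot v i ^+ r = 0.
Proof.
elim: js v r => [|j js IHjs] v r jsN.
  by under eq_bigr do rewrite big_nil mulr1; apply: power_sums_all.
(* Differentiate the identity for js and r + 1 in the direction of coordinate j. *)
pose nu i := mu i * \prod_(l <- js) x i l.
have nu0 w : \sum_i nu i * dot w i ^+ r.+1 = 0 by apply: IHjs; rewrite addnS -addSn.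
have : binom_pow_poly nu (dot v) (x^~ j) r.+1 = 0.
  apply: binom_pow_poly_eq0 => t _.
  rewrite -[RHS](nu0 (fun l => v l + (l == j)%:R * t%:R)); apply: eq_bigr => i _.
  congr (_ * _ ^+ _); rewrite /dot; under [RHS]eq_bigr do rewrite mulrDl.
  rewrite big_split/= [X in _ = _ + X](bigD1 j)//= eqxx mul1r mulrC.
  by rewrite [X in _ = _ + (_ + X)]big1 ?addr0// => l /negbTE ->; rewrite !mul0r.
move=> /(congr1 (fun q : {poly F} => q^`().[0])).
rewrite deriv_binom_pow_poly linear0 horner0 => /eqP.
rewrite mulf_eq0 pnatr_eq0/= => /eqP nu1; rewrite -[RHS]nu1; apply: eq_bigr => i _.
by rewrite big_cons /nu; congr (_ * _); rewrite -mulrA [X in _ * X]mulrC.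
Qed.

(** Each affine factor splits into a product with one more coordinate and a multiple of the shorter
    product. A nonempty [js] keeps constant terms out, since nothing is assumed about the moment of
    order 0. *)
Lemma affine_products (js : seq 'I_d) (cs : seq ('I_d * F)) :
  (0 < size js)%N -> (size js + size cs <= N)%N ->
  \sum_i mu i * (\prod_(j <- js) x i j) * \prod_(c <- cs) (x i c.1 - c.2) = 0.
Proof.
elim: cs js => [|[j c] cs IHcs] js js0 jsN.
  under eq_bigr => i _ do rewrite big_nil -[1](expr0 (dot (fun=> 0) i)).
  by apply: polarization; rewrite addn0 in jsN *; rewrite js0.
have := IHcs (j :: js) isT; rewrite addSnnS => /(_ jsN).
have := IHcs js js0 (leq_trans _ jsN); rewrite leq_add2l => /(_ (leqnSn _)).
move=> /(congr1 (fun z => c * z)); rewrite mulr0 mulr_sumr => H0 H1.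
have := congr2 (fun a b => a - b) H1 H0; rewrite subrr -sumrB => S0.
rewrite -[RHS]S0; apply: eq_bigr => i _.
by rewrite !big_cons/=; ring.
Qed.
End Multimoments.

Lemma grid_determined (F : numFieldType) (d n N : nat)
    (mu : {ffun 'I_d -> 'I_n} -> F) :
  (0 < d)%N -> (d * n < N)%N ->
  (forall v : 'I_d -> nat, (forall j, v j <= N)%N -> forall r, (0 < r <= N)%N ->
    \sum_s mu s * (\sum_j (v j)%:R * (s j).+1%:R) ^+ r = 0) ->
  forall s, mu s = 0.
Proof.
move=> d0 dnN ps s.
(* Lagrange polynomial of [s]: its factors vanish somewhere at every other grid point. The extra
   coordinate factor [js] removes the constant term and is nonzero at [s] because coordinates start
   at 1. *)
pose cs : seq ('I_d * F) :=
  [seq (jc.1, (jc.2 : nat).+1%:R) |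
     jc : 'I_d * 'I_n <- enum [pred jc : 'I_d * 'I_n | s jc.1 != jc.2]].
have := affine_products (x := fun (s : {ffun 'I_d -> 'I_n}) j => (s j).+1%:R)
  ps (js := [:: Ordinal d0]) (cs := cs) isT.
have -> : (size [:: Ordinal d0] + size cs <= N)%N.
  rewrite size_map -cardE (leq_trans _ dnN)// ltnS.
  by rewrite (leq_trans (max_card _))// card_prod !card_ord.
move=> /(_ isT); rewrite (bigD1 s)//= [X in _ + X]big1 => [|t ts].
  rewrite addr0 big_seq1 => /eqP; rewrite -mulrA mulf_eq0 => /orP[/eqP //|].
  rewrite mulf_eq0 pnatr_eq0/= => /eqP; rewrite big_map => /eqP.
  rewrite prodf_seq_eq0 => /hasP[[j c]]; rewrite mem_enum inE/= => sjc.
  by rewrite subr_eq0 eqr_nat eqSS => /eqP /val_inj /eqP; rewrite (negbTE sjc).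
have [j tj] : exists j, t j != s j.
  by apply/existsP; rewrite -negb_forall; apply: contraNN ts => /forallP ts;
    apply/eqP/ffunP => j; apply/eqP.
apply/eqP; rewrite mulf_eq0; apply/orP; right; rewrite big_map prodf_seq_eq0.
apply/hasP; exists (j, t j); first by rewrite mem_enum inE/= eq_sym.
by rewrite /= subrr.
Qed.

(** * Sums of independent categorical random vectors *)

(** A named copy of the finite function type, to which the discrete sigma-algebra is attached; every
    map out of it is then measurable. *)
Definition choices (m k : nat) : Type := {ffun 'I_m -> 'I_k.+1}.

Section Choices.
Variables m k : nat.
HB.instance Definition _ := Finite.on (choices m k).
HB.instance Definition _ :=
  isPointed.Build (choices m k) [ffun=> ord0].
HB.instance Definition _ := @isMeasurable.Build default_measure_display
  (choices m k) discrete_measurable discrete_measurable0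
  discrete_measurableC discrete_measurableU.
End Choices.

Record stochastic (R : realType) (m k : nat) := Stochastic {
  row_prob :> 'I_m -> 'I_k.+1 -> R;
  row_prob_ge0 : forall i j, 0 <= row_prob i j;
  row_prob_sum1 : forall i, \sum_j row_prob i j = 1 }.

Section ProductLaw.
Context {R : realType} {m k : nat} (p : stochastic R m k).

Definition weight (f : choices m k) : R := \prod_i p i (f i).

Lemma weight_ge0 f : 0 <= weight f.
Proof. by apply: prodr_ge0 => i _; exact: row_prob_ge0. Qed.

Lemma sum_weightM (g : 'I_m -> 'I_k.+1 -> R) :
  \sum_f weight f * \prod_i g i (f i) = \prod_i \sum_j p i j * g i j.
Proof. by rewrite bigA_distr_bigA; apply: eq_bigr => f _; rewrite -big_split. Qed.

Definition product_law (A : set (choices m k)) : \bar R :=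
  (\sum_f mscale (NngNum (weight_ge0 f)) (dirac f) A)%E.

Let product_law0 : product_law set0 = 0%E.
Proof. by rewrite /product_law big1 // => f _; rewrite measure0. Qed.

Let product_law_ge0 A : (0 <= product_law A)%E.
Proof. exact: sume_ge0. Qed.

Let product_law_sigma_additive : semi_sigma_additive product_law.
Proof.
move=> F mF tF mUF; rewrite [X in _ --> X](_ : _ =
    lim ((fun n => \sum_(0 <= i < n) product_law (F i))%E @ \oo)).
  by apply: is_cvg_ereal_nneg_natsum => j _; exact: product_law_ge0.
rewrite nneseries_sum//; apply: eq_bigr => /= f _.
exact: measure_semi_bigcup.
Qed.

HB.instance Definition _ := isMeasure.Build _ _ _ product_law
  product_law0 product_law_ge0 product_law_sigma_additive.

Lemma product_lawE A : product_law A = (\sum_f weight f * (f \in A)%:R)%:E.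
Proof.
by rewrite /product_law -sumEFin; apply: eq_bigr => f _; rewrite /mscale/= diracE.
Qed.

Let product_law_setT : product_law setT = 1%E.
Proof.
rewrite product_lawE; congr EFin.
transitivity (\sum_f weight f * \prod_(i < m) (fun _ _ => 1) i (f i)).
  by apply: eq_bigr => f _; rewrite in_setT big1_eq.
rewrite (sum_weightM (fun _ _ => 1)) big1 // => i _.
by rewrite -[RHS](row_prob_sum1 p i); apply: eq_bigr => j _; rewrite mulr1.
Qed.

HB.instance Definition _ := Measure_isProbability.Build _ _ _
  product_law product_law_setT.

Lemma product_law_box (A : 'I_m -> set 'I_k.+1) :
  product_law [set f | forall i, A i (f i)] =
  (\prod_i \sum_j p i j * (j \in A i)%:R)%:E.
Proof.
rewrite product_lawE -(sum_weightM (fun i j => (j \in A i)%:R)); congr EFin.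
apply: eq_bigr => f _; congr (_ * _).
have [Af|/existsNP[i nAi]] := pselect (forall i, A i (f i)).
  by rewrite mem_set// big1// => i _; rewrite mem_set.
by rewrite memNset/= => [|/(_ i)//]; rewrite (bigD1 i)//= memNset// mul0r.
Qed.

End ProductLaw.

Section PMD.
Context {R : realType} {m k : nat} (p : stochastic R m k).

Definition outcome (i : 'I_m) (f : choices m k) : borel_rV R k.+1 :=
  delta_mx 0 (f i).

Definition choice_sum (f : choices m k) : borel_rV R k.+1 :=
  \sum_(i < m) (outcome i f : 'rV[R]_k.+1).

Lemma measurable_choices d (T : measurableType d) (X : choices m k -> T) :
  measurable_fun setT X.
Proof. by []. Qed.

HB.instance Definition _ i := isMeasurableFun.Build _ _ _ _ (outcome i)
  (measurable_choices (outcome i)).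
HB.instance Definition _ := isMeasurableFun.Build _ _ _ _ choice_sum
  (measurable_choices choice_sum).

Definition pmd : probability (borel_rV R k.+1) R :=
  distribution (product_law p) choice_sum.

Lemma pmd_is_PMD : is_PMD m pmd.
Proof.
exists _, _, (product_law p), (fun i => outcome i); split => //.
- move=> i; rewrite /is_CRV /distribution /pushforward.
  rewrite -(probability_setT (product_law p)); congr (product_law p _).
  by apply/seteqP; split => // f _; exists (f i).
- move=> A _; pose B i : set 'I_k.+1 := [set j | A i (delta_mx 0 j)].
  transitivity (product_law p [set f | forall i, B i (f i)]).
    congr (product_law p _); apply/seteqP; split => f /= Af i; first exact: Af.
    by move=> _; exact: Af.
  rewrite product_law_box -prodEFin; apply: eq_bigr => i _.
  (* An event on the single coordinate [i] is a box whose other sides are full. *)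
  transitivity (product_law p
    [set f | forall i', (if i' == i then B i else setT) (f i')]); last first.
    congr (product_law p _); apply/seteqP; split => f /=.
      by move=> /(_ i); rewrite eqxx.
    by move=> Bf i'; case: eqVneq => [->|].
  rewrite (product_law_box p (fun i' => if i' == i then B i else setT)).
  congr EFin.
  rewrite (bigD1 i)//= eqxx [X in _ * X]big1 ?mulr1// => i' /negbTE ->.
  rewrite -[RHS](row_prob_sum1 p i'); apply: eq_bigr => j _.
  by rewrite in_setT mulr1.
Qed.

End PMD.

(** * Total variation distance and factorial moments *)

Section TotalVariation.
Variables (R : realType) (m k : nat).
Implicit Types (p q : stochastic R m k) (f g : choices m k).

(** The image is finite, hence closed in a Hausdorff space, hence Borel. *)
Lemma measurable_choice_sum_image (E : set (choices m k)) :
  measurable (@choice_sum R m k @` E).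
Proof.
have cE : closed (@choice_sum R m k @` E : set 'rV[R]_k.+1).
  have hV : hausdorff_space 'rV[R]_k.+1 by exact: norm_hausdorff.
  have /accessible_finite_set_closed cF := hausdorff_accessible hV.
  by apply: cF; exact: finite_image.
rewrite -[X in measurable X]setCK; apply: measurableC.
by apply: sub_sigma_algebra; exact: closed_openC.
Qed.

(** An event saturated for [choice_sum] is the preimage of its own image, so it competes in the
    supremum defining [dTV]. *)
Lemma dTV_event p q (E : set (choices m k)) (eps : R) :
  (forall f g, @choice_sum R m k f = choice_sum g -> E f -> E g) ->
  (dTV (pmd p) (pmd q) < eps%:E)%E ->
  `|\sum_f weight p f * (f \in E)%:R - \sum_f weight q f * (f \in E)%:R| <= eps.
Proof.
move=> satE dlt; rewrite -lee_fin; apply: le_trans (ltW dlt).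
rewrite -abse_EFin EFinB -!product_lawE.
have EE : @choice_sum R m k @^-1` (@choice_sum R m k @` E) = E.
  apply/seteqP; split => [f [g Eg gf]|f Ef]; first exact: satE gf Eg.
  by exists f.
apply: ereal_sup_ubound; exists (@choice_sum R m k @` E).
  exact: measurable_choice_sum_image.
by rewrite /pmd /distribution /pushforward/= EE.
Qed.

Lemma choice_sum_count f j :
  (choice_sum f : 'rV[R]_k.+1) 0 j = #|[set i | f i == j]%SET|%:R.
Proof.
rewrite /choice_sum summxE -sum1_card natr_sum [RHS]big_mkcond/=; apply: eq_bigr => i _.
by rewrite /outcome mxE eqxx/= inE eq_sym; case: eqP.
Qed.

(** The polynomial depends only on how many summands take each value, and the sum records these
    counts. Hence its coefficients are statistics of the PMD. *)
Lemma esym_poly_choice_sum (A : comNzSemiRingType) (u : 'I_k.+1 -> A) f g :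
  @choice_sum R m k f = choice_sum g -> esym_poly (u \o f) = esym_poly (u \o g).
Proof.
have part h : esym_poly (u \o h) = \prod_j (1 + u j *: 'X) ^+ #|[set i | h i == j]%SET|.
  rewrite /esym_poly (partition_big h predT)//=; apply: eq_bigr => j _.
  rewrite -prodr_const; apply: eq_big => [i|i /eqP <-//].
  by rewrite inE.
move=> fg; rewrite !part; apply: eq_bigr => j _; congr (_ ^+ _).
by apply/eqP; rewrite -(eqr_nat R) -!choice_sum_count fg.
Qed.

(** By independence, the expectation of a product of linear factors is the product of their
    expectations. *)
Lemma expectation_esym p (u : 'I_k.+1 -> R) r :
  \sum_f weight p f * (esym_poly (u \o f))`_r =
  (esym_poly (fun i => \sum_j p i j * u j))`_r.
Proof.
transitivity (\sum_f weight p f *: esym_poly (u \o f))`_r.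
  by rewrite coef_sum; apply: eq_bigr => f _; rewrite coefZ.
apply: (congr1 (fun q : {poly R} => q`_r)); rewrite /esym_poly.
transitivity (\prod_i \sum_j (p i j)%:P * (1 + u j *: 'X)); last first.
  apply: eq_bigr => i _; under eq_bigr do rewrite mulrDr mulr1.
  rewrite big_split/= -rmorph_sum row_prob_sum1 scaler_suml; congr (_ + _).
  by apply: eq_bigr => j _; rewrite mul_polyC scalerA.
rewrite bigA_distr_bigA/=; apply: eq_bigr => f _.
by rewrite big_split/= -rmorph_prod mul_polyC.
Qed.

(* Layer-cake: a statistic with values in [0, B] is a sum of B indicators. *)
Lemma dTV_coef_esym p q (u : 'I_k.+1 -> nat) (B r : nat) (eps : R) :
  (forall f, ((esym_poly (u \o f))`_r)%R <= B)%N ->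
  (dTV (pmd p) (pmd q) < eps%:E)%E ->
  `|(esym_poly (fun i => \sum_j p i j * (u j)%:R))`_r -
    (esym_poly (fun i => \sum_j q i j * (u j)%:R))`_r| <= B%:R * eps.
Proof.
move=> uB dlt; pose E c := [set f : choices m k | (c < ((esym_poly (u \o f))`_r)%R)%N].
have layers (w : stochastic R m k) : (esym_poly (fun i => \sum_j w i j * (u j)%:R))`_r =
    \sum_(c < B) \sum_f weight w f * (f \in E c)%:R.
  rewrite -(expectation_esym _ (fun j => (u j)%:R)) exchange_big/=.
  apply: eq_bigr => f _; rewrite -mulr_sumr; congr (_ * _).
  rewrite (coef_esym_natr _ (u \o f)) -natr_sum; congr (_%:R).
  rewrite -[LHS]card_ord -sum1_card (big_ord_widen _ (fun=> 1%N) (uB f)).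
  rewrite big_mkcond/=; apply: eq_bigr => c _.
  by case: ltnP => ce; [rewrite mem_set
    |rewrite memNset//=; apply/negP; rewrite -leqNgt].
rewrite !layers -sumrB (le_trans (ler_norm_sum _ _ _))//.
rewrite -[B in leRHS]card_ord -sumr_const mulr_suml; apply: ler_sum => c _.
rewrite mul1r; apply: dTV_event dlt => f g fg.
by rewrite /E/= (esym_poly_choice_sum u fg).
Qed.

(** After scaling by [D ^ r] both coefficients are natural numbers, and they differ by less than
    1. *)
Lemma dTV_esym_nat p q (u : 'I_k.+1 -> nat) (x y : 'I_m -> nat) (V D r : nat)
    (eps : R) :
  (forall j, u j <= V)%N ->
  (forall i, D%:R * \sum_j p i j * (u j)%:R = (x i)%:R) ->
  (forall i, D%:R * \sum_j q i j * (u j)%:R = (y i)%:R) ->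
  eps * (m * V * D)%:R ^+ r < 1 ->
  (dTV (pmd p) (pmd q) < eps%:E)%E ->
  (esym_poly x)`_r = (esym_poly y)`_r.
Proof.
move=> uV xE yE small dlt.
have uB f : (((esym_poly (u \o f))`_r)%R <= (m * V) ^ r)%N.
  rewrite (leq_trans (coef_esym_le _ _))//; case: (r) => // r'.
  rewrite leq_exp2r//; apply: (@leq_trans (\sum_(i < m) V)%N).
    by apply: leq_sum => i _; exact: uV.
  by rewrite big_const_ord iter_addn addn0 mulnC.
have := dTV_coef_esym uB dlt.
move=> /(ler_wpM2l (exprn_ge0 r (ler0n R D))).
rewrite -[X in X * `|_|]ger0_norm ?exprn_ge0// -normrM mulrBr -!coef_esym_scale.
have -> : esym_poly (fun i => D%:R * \sum_j p i j * (u j)%:R) =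
    esym_poly (fun i => (x i)%:R : R) by apply: eq_bigr => i _; rewrite xE.
have -> : esym_poly (fun i => D%:R * \sum_j q i j * (u j)%:R) =
    esym_poly (fun i => (y i)%:R : R) by apply: eq_bigr => i _; rewrite yE.
rewrite !coef_esym_natr natrX mulrA -exprMn -natrM [(D * _)%N]mulnC mulrC.
move=> /le_lt_trans /(_ small).
set a := (_`_r)%R; set b := ((esym_poly y)`_r)%R.
rewrite -[a%:R]/(a%:Z%:~R) -[b%:R]/(b%:Z%:~R).
rewrite -intrB -intr_norm -[1]/(1%:~R) ltr_int => ab.
by apply/eqP; rewrite -eqz_nat -subr_eq0 -normr_le0; lia.
Qed.
End TotalVariation.

(** * The packing *)

(* The coordinate [ord0] plays the role of e_k: it receives the mass that the
   integer vector [x i], scaled by [1 / D], leaves over. *)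
Section LatticeRows.
Variables (R : realType) (m d D : nat).

Lemma lattice_row_ge0 (x : 'I_m -> 'I_d -> nat) :
  (forall i, \sum_l x i l <= D)%N -> forall i (j : 'I_d.+1),
  0 <= (if unlift ord0 j is Some l then (x i l)%:R / D%:R
        else 1 - (\sum_l x i l)%:R / D%:R :> R).
Proof.
move=> xD i j; case: unliftP => [l _|_]; first exact: divr_ge0.
(* When [D] is 0 its inverse is 0 by convention, and the leftover mass is 1. *)
rewrite subr_ge0; case: (posnP D) => [->|D0]; first by rewrite invr0 mulr0.
by rewrite ler_pdivrMr ?ltr0n// mul1r ler_nat.
Qed.

Lemma lattice_row_sum1 (x : 'I_m -> 'I_d -> nat) i :
  \sum_j (if unlift ord0 j is Some l then (x i l)%:R / D%:R
        else 1 - (\sum_l x i l)%:R / D%:R) = 1 :> R.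
Proof.
rewrite big_ord_recl unlift_none; under [X in _ + X]eq_bigr do rewrite liftK.
by rewrite -mulr_suml natr_sum subrK.
Qed.

Definition lattice_rows (x : 'I_m -> 'I_d -> nat)
    (xD : forall i, (\sum_l x i l <= D)%N) : stochastic R m d :=
  Stochastic (lattice_row_ge0 xD) (lattice_row_sum1 x).

Lemma dTV_lattice_rows (x y : 'I_m -> 'I_d -> nat)
    (xD : forall i, (\sum_l x i l <= D)%N) (yD : forall i, (\sum_l y i l <= D)%N)
    (v : 'I_d -> nat) (V r : nat) (eps : R) :
  (0 < D)%N -> (forall l, v l <= V)%N -> eps * (m * V * D)%:R ^+ r < 1 ->
  (dTV (pmd (lattice_rows xD)) (pmd (lattice_rows yD)) < eps%:E)%E ->
  (esym_poly (fun i => \sum_l v l * x i l)%N)`_r =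
  (esym_poly (fun i => \sum_l v l * y i l)%N)`_r.
Proof.
move=> D0 vV small dlt.
(* Value 0 at [ord0] makes the leftover mass invisible, so each scaled row mean is the integer dot
   product of [v] and the row. *)
pose u (j : 'I_d.+1) := if unlift ord0 j is Some l then v l else 0%N.
have dotE z (zD : forall i, (\sum_l z i l <= D)%N) i :
    D%:R * \sum_j lattice_rows zD i j * (u j)%:R = (\sum_l v l * z i l)%N%:R.
  rewrite big_ord_recl /u unlift_none mulr0 add0r natr_sum mulr_sumr.
  apply: eq_bigr => l _; rewrite /= liftK natrM mulrA.
  rewrite [D%:R * _]mulrC divfK ?pnatr_eq0 -?lt0n//.
  by rewrite mulrC.
apply: (dTV_esym_nat (u := u) _ (dotE _ xD) (dotE _ yD) small dlt) => j.
by rewrite /u; case: unlift.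
Qed.
End LatticeRows.

Section Packing.
Variables (R : realType) (d n : nat).
Hypotheses (d0 : (0 < d)%N) (n0 : (0 < n)%N).

Local Notation grid := {ffun 'I_d -> 'I_n}.
(** Serves as common denominator, as bound on the test vectors, and as the highest order of moments
    compared; for positive [n] it exceeds [d * n], as [grid_determined] requires. *)
Local Notation N := (d.+1 * n)%N.

(** Unselected points keep a zero row, so the number of summands does not depend on [S]; the
    successor places coordinates in 1..n. *)
Definition selected (S : {set grid}) (i : 'I_#|grid|) (l : 'I_d) : nat :=
  if enum_val i \in S then (enum_val i l).+1 else 0.

Lemma selected_le S i : (\sum_l selected S i l <= N)%N.
Proof.
apply: (@leq_trans (\sum_(l < d) n)%N).
  by apply: leq_sum => l _; rewrite /selected; case: ifP.
by rewrite big_const_ord iter_addn addn0 mulSn mulnC leq_addl.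
Qed.

Definition grid_pmd (S : {set grid}) := pmd (lattice_rows R (selected_le S)).

Lemma grid_pmd_separated (S S' : {set grid}) (eps : R) :
  (forall r, (r <= N)%N -> eps * (#|{: grid}| * N * N)%:R ^+ r < 1) ->
  S != S' -> (eps%:E <= dTV (grid_pmd S) (grid_pmd S'))%E.
Proof.
move=> small; apply: contraNT; rewrite -ltNge => dlt.
have N0 : (0 < N)%N by rewrite muln_gt0.
pose mu (s : grid) : R := (s \in S)%:R - (s \in S')%:R.
suff mu0 s : mu s = 0.
  apply/eqP/setP => s; have /eqP := mu0 s; rewrite subr_eq0 eqr_nat.
  by case: (s \in S); case: (s \in S').
apply: (@grid_determined R d n N mu) => // [|v vN r rN].
  by rewrite ltn_pmul2r.
(* Since [r] is positive, the zero rows of unselected points contribute nothing. *)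
have sumE (T : {set grid}) : \sum_i ((\sum_l v l * selected T i l)%N%:R : R) ^+ r =
    \sum_s (s \in T)%:R * (\sum_j (v j)%:R * (s j).+1%:R) ^+ r.
  rewrite [RHS](reindex _ (onW_bij _ (@enum_val_bij grid)))/=.
  apply: eq_bigr => i _; rewrite /selected; case: (enum_val i \in T).
    by rewrite mul1r natr_sum; under eq_bigr do rewrite natrM.
  by rewrite mul0r big1 ?expr0n => [|l _]; rewrite ?muln0//; case: r rN.
under eq_bigr do rewrite mulrBl.
have := power_sums_eq (N := N) (A := R)
  (a := fun i => (\sum_l v l * selected S i l)%N%:R)
  (b := fun i => (\sum_l v l * selected S' i l)%N%:R).
move=> /(_ _ r rN); rewrite sumrB !sumE => ->; first by rewrite subrr.
move=> r' r'N; rewrite !coef_esym_natr; congr (_%:R).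
exact: (dTV_lattice_rows N0 vN (small r' r'N) dlt).
Qed.
End Packing.

(* Covers the bounded range of [log2 eps^-1] for which the grid would be empty. *)
Lemma two_separated_pmds (R : realType) (d : nat) : (0 < d)%N ->
  exists Z : 'I_2 -> probability (borel_rV R d.+1) R,
    (forall i, is_PMD 1 (Z i)) /\
    (forall i j eps, i != j -> eps < 1 -> (eps%:E <= dTV (Z i) (Z j))%E).
Proof.
(* With denominator 1 the two laws are point masses at distinct basis vectors, told apart by the
   first moment. *)
move=> d0; pose x (b : 'I_2) (i : 'I_1) (l : 'I_d) : nat := (b * (l == Ordinal d0))%N.
have sumx b i : (\sum_l x b i l = b)%N.
  rewrite (bigD1 (Ordinal d0))//= big1 /x => [|l /negbTE ->]; last by rewrite muln0.
  by rewrite eqxx muln1 addn0.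
have x1 b i : (\sum_l x b i l <= 1)%N by rewrite sumx -ltnS.
exists (fun b => pmd (lattice_rows R (x1 b))); split => [b|a b eps ab eps1].
  exact: pmd_is_PMD.
rewrite leNgt; apply: contraNN ab => dlt.
have := @dTV_lattice_rows _ _ _ _ _ _ (x1 a) (x1 b) (fun=> 1%N) 1 1
  eps isT (fun=> leqnn 1).
rewrite expr1 mulr1 => /(_ eps1 dlt).
rewrite /esym_poly !big_ord1 !coefD !coef1 !coefZ !coefX !mulr1 !add0r/=.
by under eq_bigr do rewrite mul1n; under [X in _ = X -> _]eq_bigr do rewrite mul1n;
  rewrite !sumx => /val_inj ->.
Qed.

(** * Choice of the grid side and size estimates *)

Lemma ln2_gt0 (R : realType) : 0 < ln (2 : R).
Proof. by rewrite ln_gt0// ltr1n. Qed.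

Lemma ln_log2 (R : realType) (x : R) : ln x = log2 x * ln 2.
Proof. by rewrite /log2 divfK// gt_eqF// ln2_gt0. Qed.

Lemma log2_ge (R : realType) (x : R) (j : nat) : 2 ^+ j <= x -> j%:R <= log2 x.
Proof.
move=> jx; have x0 : 0 < x by apply: lt_le_trans jx; rewrite exprn_gt0.
by rewrite ler_pdivlMr ?ln2_gt0// mulr_natl -lnXn// ler_ln ?posrE// exprn_gt0.
Qed.

Lemma grid_side_le (R : realType) (d n : nat) (L : R) :
  1 <= log2 L -> n%:R * (4 * d.+1%:R ^+ 2 * log2 L) <= L -> n%:R <= L.
Proof.
move=> lg1; apply: le_trans; rewrite ler_peMr//; apply: mulr_ege1 => //.
by rewrite mulr_ege1 ?ler1n ?exprn_ege1// ler1n.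
Qed.

Lemma grid_separation_small (R : realType) (d n r : nat) (eps : R) :
  let L := log2 eps^-1 in let N := (d.+1 * n)%N in
  (0 < d)%N -> (0 < n)%N -> 0 < eps -> 2 <= L ->
  n%:R * (4 * d.+1%:R ^+ 2 * log2 L) <= L -> (r <= N)%N ->
  eps * (n ^ d * N * N)%:R ^+ r < 1.
Proof.
move=> L N d0 n0 eps0 L2 nL rN.
have L0 : 0 < L by apply: lt_le_trans L2.
have lg1 : 1 <= log2 L by rewrite -[1]/(1%:R) log2_ge// expr1.
have n1 : 1 <= n%:R :> R by rewrite ler1n.
have d1 : 1 <= d.+1%:R :> R by rewrite ler1n.
have nleL : n%:R <= L := grid_side_le lg1 nL.
have dleL : d.+1%:R <= L ^+ d.+1.
  apply: (@le_trans _ _ (2 ^+ d.+1)); last by rewrite lerXn2r// nnegrE ltW.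
  by rewrite -natrX ler_nat ltnW// ltn_expl.
(* Two factors [d.+1], each at most [L ^+ d.+1], and [d.+2] factors [n], each at most [L], give the
   exponent [2 * d.+1 + d.+2]. *)
pose e := (3 * d.+1 + 1)%N.
have base : (n ^ d * N * N)%:R <= L ^+ e :> R.
  have -> : (n ^ d * N * N)%:R = d.+1%:R ^+ 2 * n%:R ^+ d.+2 :> R.
    by rewrite /N !natrM natrX !exprS; ring.
  have -> : L ^+ e = (L ^+ d.+1) ^+ 2 * L ^+ d.+2.
    by rewrite -exprM -exprD; congr (_ ^+ _); rewrite /e; lia.
  have L0' := ltW L0.
  by rewrite ler_pM ?exprn_ge0// lerXn2r// ?nnegrE ?exprn_ge0.
have L1 : 1 <= L by apply: le_trans L2; rewrite ler1n.
apply: (@le_lt_trans _ _ (eps * L ^+ (e * N))).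
  rewrite ler_pM2l// exprM; apply: (@le_trans _ _ ((L ^+ e) ^+ r)).
    by rewrite lerXn2r// nnegrE ?ler0n ?exprn_ge0// ltW.
  by rewrite ler_weXn2l// exprn_ege1.
rewrite -ltr_pdivlMl// mulr1 -ltr_ln ?posrE ?exprn_gt0 ?invr_gt0//.
rewrite lnXn// ln_log2 [ltRHS]ln_log2 -/L -mulrnAl ltr_pM2r ?ln2_gt0//.
rewrite -[ltLHS]mulr_natl.
apply: lt_le_trans nL; rewrite [ltRHS]mulrA ltr_pM2r; last exact: lt_le_trans lg1.
(* This is where [d > 0] enters: it gives [3 * d.+1 + 1 < 4 * d.+1]. *)
rewrite /N /e -natrX -!natrM ltr_nat; nia.
Qed.

Lemma card_grid_sets (d n : nat) : #|{: {set {ffun 'I_d -> 'I_n}}}| = (2 ^ n ^ d)%N.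
Proof. by rewrite -cardsT -powersetT card_powerset cardsT card_ffun !card_ord. Qed.

(** Since [n.+1 <= 2 * maxn 1 n], rounding the side down costs at most a factor 2, whence
    [c1 / 2]. *)
Lemma card_grid_sets_ge (R : realType) (d n : nat) (L : R) :
  let c1 := (4 * d.+1%:R ^+ 2)^-1 in
  0 < log2 L -> 0 <= L -> L / log2 L * c1 < n.+1%:R ->
  2 `^ ((c1 / 2) ^+ d * (L ^+ d / log2 L ^+ d)) <= (2 ^ maxn 1 n ^ d)%N%:R :> R.
Proof.
move=> c1 lg0 L0 Ln.
rewrite natrX -(powR_mulrn _ (ler0n R 2)) ler_powR ?ler1n// natrX -expr_div_n -exprMn.
have c10 : 0 < c1 by rewrite invr_gt0 mulr_gt0// exprn_gt0.
have c20 : 0 <= c1 / 2 by rewrite divr_ge0// ltW.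
have q0 : 0 <= L / log2 L by rewrite divr_ge0// ltW.
apply: lerXn2r; rewrite ?nnegrE ?ler0n//; first exact: mulr_ge0.
rewrite [_ * c1]mulrC in Ln.
rewrite mulrAC ler_pdivrMr// (le_trans (ltW Ln))// -natrM ler_nat.
by lia.
Qed.

Unset Implicit Arguments.

Theorem theorem35 (R : realType) :
  exists C : R, 0 < C /\
  forall k : nat, (2 <= k)%N ->
  exists (c : R) (a : nat), 0 < c /\
  forall eps : R, 0 < eps -> eps <= 4^-1 ->
  exists (m l : nat) (Z : 'I_l -> probability (borel_rV R k) R),
    [/\ m%:R <= C * log2 eps^-1 ^+ (k - 1),
        2 `^ (c * (log2 eps^-1 ^+ (k - 1) / log2 (log2 eps^-1) ^+ a)) <= l%:R,
        forall i : 'I_l, is_PMD m (Z i) &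
        forall i j : 'I_l, (i < j)%N -> (eps%:E <= dTV (Z i) (Z j))%E].
Proof.
exists 1; split => // -[//|d] d0; rewrite subSS subn0.
(* Inverse of the constant that bounds the exponent in [grid_separation_small]. *)
pose c1 : R := (4 * d.+1%:R ^+ 2)^-1.
have c10 : 0 < c1 by rewrite invr_gt0 mulr_gt0// exprn_gt0.
exists ((c1 / 2) ^+ d), d; split; first by rewrite exprn_gt0// divr_gt0.
move=> eps eps0 eps4; set L := log2 eps^-1.
have L2 : 2 <= L.
  by apply: log2_ge; rewrite -natrX -[(2 ^ 2)%:R]invrK lef_pV2// posrE invr_gt0.
have L0 : 0 < L by apply: lt_le_trans L2.
have L1 : 1 <= L by apply: le_trans L2; rewrite ler1n.
have lg1 : 1 <= log2 L by rewrite -[1]/(1%:R) log2_ge// expr1.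
have lg0 : 0 < log2 L by apply: lt_le_trans lg1.
pose n := Num.truncn (L / log2 L * c1).
have x0 : 0 <= L / log2 L * c1 by rewrite mulr_ge0 ?(ltW c10)// divr_ge0// ltW.
have := card_grid_sets_ge lg0 (ltW L0) (truncnS_gt (L / log2 L * c1)); rewrite -/n /=.
(* For an empty grid the required count is at most 2, so two laws with [m = 1] suffice. *)
have [n0|n0] := posnP n.
  rewrite n0 maxn0 exp1n expn1 => lge.
  have [Z [ZP Zsep]] := two_separated_pmds R d0.
  exists 1%N, 2, Z; split => //.
    by rewrite mul1r exprn_ege1.
  move=> i j ij; apply: Zsep; first by rewrite neq_ltn ij.
  by apply: le_lt_trans eps4 _; rewrite invf_lt1// ltr1n.
rewrite (maxn_idPr n0) -card_grid_sets => lge.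
have nL : n%:R * (4 * d.+1%:R ^+ 2 * log2 L) <= L.
  have : n%:R <= L / log2 L * c1 by rewrite truncn_le.
  by rewrite /c1 ler_pdivlMr ?mulr_gt0 ?exprn_gt0// ler_pdivlMr// mulrA.
pose family := {: {set {ffun 'I_d -> 'I_n}}}.
exists #|{: {ffun 'I_d -> 'I_n}}|, #|family|,
  (fun i : 'I_#|family| => grid_pmd R (enum_val i)); split.
- rewrite mul1r card_ffun !card_ord natrX lerXn2r ?nnegrE ?(ltW L0)//.
  exact: grid_side_le lg1 nL.
- exact: lge.
- by move=> i; exact: pmd_is_PMD.
- move=> i j ij; apply: grid_pmd_separated => //.
    move=> r rN; rewrite card_ffun !card_ord.
    exact: grid_separation_small d0 n0 eps0 L2 nL rN.
  by rewrite (inj_eq enum_val_inj) neq_ltn ij.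
Qed.
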